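(* There is an absolute constant $C_1>0$ such that the following holds. Let $k=k(n)$ and $d=d(n)$ be positive integers with $k\,d\log_2 d=o(n)$. Then for all sufficiently large $n$, as classes of Boolean functions $f:\{0,1\}^n\to\{0,1\}$, $$k\text{-id-}\mathbf{QOBDD}_{\sqrt{d/(C_1k)}}\subsetneq k\text{-id-}\mathbf{QOBDD}_{d^2}.$$
   Context: A quantum $k$-OBDD ($k$-QOBDD) of width $w$ on $n$ input bits with order $\pi$ (a permutation of $\{1,\dots,n\}$) is given by an initial state $|q_0\rangle$ (a standard basis vector of $\mathbb{C}^w$), a set $Accept\subseteq\{1,\dots,w\}$, and for each step $s=1,\dots,kn$ a pair of unitary $w\times w$ matrices $(G_s^0,G_s^1)$. On input $\sigma\in\{0,1\}^n$, starting from $|\psi_0\rangle=|q_0\rangle$, at step $s$ the bit $\sigma_{\pi(j)}$ with $j=((s-1)\bmod n)+1$ is read and $|\psi_s\rangle=G_s^{\sigma_{\pi(j)}}|\psi_{s-1}\rangle$ (so the input is read $k$ times in order $\pi$). At the end the state $|\psi_{kn}\rangle=(v_1,\dots,v_w)$ is measured and $\sigma$ is accepted with probability $\sum_{i\in Accept}|v_i|^2$. It computes $f$ with bounded error if there is $\varepsilon>0$ such that inputs with $f(\sigma)=1$ are accepted with probability at least $1/2+\varepsilon$ and inputs with $f(\sigma)=0$ with probability at most $1/2-\varepsilon$. $k\text{-id-}\mathbf{QOBDD}_W$ is the set of Boolean functions $f:\{0,1\}^n\to\{0,1\}$ computed with bounded error by a $k$-QOBDD of width at most $W$ with the natural order $\pi=(1,\dots,n)$.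 *)

(* Defs.v *)
From mathcomp Require Import all_boot all_order all_algebra all_fingroup.
From mathcomp Require Import all_classical all_reals all_analysis.
From mathcomp Require Import complex.

Set Implicit Arguments.
Unset Strict Implicit.
Unset Printing Implicit Defensive.

Import Order.TTheory GRing.Theory Num.Theory.
Import numFieldNormedType.Exports.
Local Open Scope classical_set_scope.
Local Open Scope ring_scope.

Definition boolfun (n : nat) := {ffun 'I_n -> bool} -> bool.

Lemma read_pos_subproof (k n : nat) (s : 'I_(k * n)) : (s %% n < n)%N.
Proof. by case: n s => [|n] s; [case: s => m; rewrite muln0 | exact: ltn_pmod]. Qed.

(* Steps and positions are numbered from 0, so the position read at step s
   is s mod n rather than ((s - 1) mod n) + 1. *)
Definition read_pos (k n : nat) (s : 'I_(k * n)) : 'I_n :=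
  Ordinal (read_pos_subproof s).

(* The initial state is the basis vector indexed by qinit; in particular
   the width w is necessarily positive. *)
Record kQOBDD (R : realType) (k n w : nat) := KQOBDD {
  qorder : 'S_n;
  qinit : 'I_w;
  qaccept : {set 'I_w};
  qgate : 'I_(k * n) -> bool -> 'M[R[i]]_w;
  qgate_unitary : forall s b, qgate s b \is unitarymx
}.

Section Semantics.
Variables (R : realType) (k n w : nat) (P : kQOBDD R k n w).

Definition qstep (sigma : {ffun 'I_n -> bool}) (psi : 'cV[R[i]]_w)
    (s : 'I_(k * n)) : 'cV[R[i]]_w :=
  qgate P s (sigma (qorder P (read_pos s))) *m psi.

(* enum 'I_(k * n) lists the steps in increasing order. *)
Definition qfinal (sigma : {ffun 'I_n -> bool}) : 'cV[R[i]]_w :=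
  foldl (qstep sigma) (delta_mx (qinit P) 0) (enum 'I_(k * n)).

Definition accept_prob (sigma : {ffun 'I_n -> bool}) : R :=
  \sum_(i in qaccept P) ComplexField.Normc.normc (qfinal sigma i 0) ^+ 2.

Definition computes_bounded_error (f : boolfun n) : Prop :=
  exists2 eps : R, 0 < eps &
    forall sigma,
      (f sigma = true -> 1 / 2 + eps <= accept_prob sigma) /\
      (f sigma = false -> accept_prob sigma <= 1 / 2 - eps).

End Semantics.

(* The width bound W is real, since it is instantiated with a square root;
   the natural order is the identity permutation. *)
Definition id_QOBDD (R : realType) (k n : nat) (W : R) : set (boolfun n) :=
  [set f | exists (w : nat) (P : kQOBDD R k n w),
    [/\ w%:R <= W, qorder P = 1%g & computes_bounded_error P f]].

Definition log2 (R : realType) (x : R) : R := ln x / ln 2.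

(* Main.v *)
(** For a fixed number of inputs the gap eps may be arbitrarily small, so a program
    only determines the sign of [accept_prob - 1/2], and counting arguments based on
    nets of states are not available. Instead, cut the input at a position c: the bits
    read after the cut act only through k complex w x w matrices, and for each of M
    fixed prefixes the acceptance probability is a polynomial of degree 2k in the
    2kw^2 real coordinates of these matrices. A Warren-type bound on the number of sign
    patterns of polynomials shows that at most (4kM + 1)^(2kw^2) suffixes can be
    distinguished by the M prefixes.

    The separating function reads an address in [0, m) and then m data bits, and
    returns the addressed bit; it is computed by a single pass of a reversible program
    of width 2m, while its 2^m suffixes are pairwise distinguished by m prefixes.
    For d >= 16 k take m = d * floor(log2 d): then 2m <= d^2, 2m <= n for large n, and
    16 k w^2 <= d contradicts the counting bound. For d < 16 k the smaller class is
    empty. *)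

Require Import Defs.
From mathcomp Require Import all_boot all_order all_algebra all_fingroup.
From mathcomp Require Import all_classical all_reals all_analysis.
From mathcomp Require Import complex zify lra.

Set Implicit Arguments.
Unset Strict Implicit.
Unset Printing Implicit Defensive.

Import Order.TTheory GRing.Theory Num.Theory.
Import numFieldNormedType.Exports.
Local Open Scope classical_set_scope.
Local Open Scope ring_scope.

(** * Polynomial functions of bounded degree and their sign patterns *)

Section PolynomialFunctions.
Variables (R : realType) (p : nat).
Implicit Types (f g : 'rV[R]_p -> R) (D : nat).

(** The index is an upper bound on the degree, not the degree itself. Continuity, growth,
    derivatives and monomial expansions all follow by induction on how the function is built. *)
Inductive polyfun : nat -> ('rV[R]_p -> R) -> Prop :=
| polyfun_cst c : polyfun 0 (fun=> c)
| polyfun_coord i : polyfun 1 (fun x => x 0 i)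
| polyfunD D f g : polyfun D f -> polyfun D g -> polyfun D (fun x => f x + g x)
| polyfunM D1 D2 f g :
    polyfun D1 f -> polyfun D2 g -> polyfun (D1 + D2) (fun x => f x * g x)
| polyfun_leq D1 D2 f : (D1 <= D2)%N -> polyfun D1 f -> polyfun D2 f.

Lemma polyfun_const D c : polyfun D (fun=> c).
Proof. by apply: polyfun_leq (polyfun_cst c). Qed.

Lemma polyfunZ D a f : polyfun D f -> polyfun D (fun x => a * f x).
Proof. by move=> pf; rewrite -[D]add0n; exact: polyfunM (polyfun_cst a) pf. Qed.

Lemma polyfunB D f g :
  polyfun D f -> polyfun D g -> polyfun D (fun x => f x - g x).
Proof.
move=> pf pg; have -> : (fun x => f x - g x) = (fun x => f x + (-1) * g x).
  by apply/funext => x; rewrite mulN1r.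
by apply: polyfunD => //; exact: polyfunZ.
Qed.

Lemma polyfun_sum D (I : Type) (r : seq I) (P : pred I) (F : I -> 'rV[R]_p -> R) :
  (forall i, polyfun D (F i)) -> polyfun D (fun x => \sum_(i <- r | P i) F i x).
Proof.
move=> pF; elim: r => [|i r IHr].
  by under eq_fun do rewrite big_nil; exact: polyfun_const.
under eq_fun do rewrite big_cons.
by case: (P i) => //; exact: polyfunD.
Qed.

Lemma polyfun_prod D (I : Type) (r : seq I) (F : I -> 'rV[R]_p -> R) :
  (forall i, polyfun D (F i)) ->
  polyfun (size r * D) (fun x => \prod_(i <- r) F i x).
Proof.
move=> pF; elim: r => [|i r IHr].
  by under eq_fun do rewrite big_nil; exact: polyfun_const.
under eq_fun do rewrite big_cons.
by rewrite mulSn; exact: polyfunM.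
Qed.

Lemma polyfunX D n f : polyfun D f -> polyfun (n * D) (fun x => f x ^+ n).
Proof.
move=> pf; elim: n => [|n IHn].
  by under eq_fun do rewrite expr0; exact: polyfun_const.
by under eq_fun do rewrite exprS; rewrite mulSn; exact: polyfunM.
Qed.

Lemma polyfun_continuous D f : polyfun D f -> continuous f.
Proof.
elim=> {D f} [c|i|D f g _ cf _ cg|D1 D2 f g _ cf _ cg|//] x.
- exact: cst_continuous.
- exact: coord_continuous.
- by apply: continuousD; [exact: cf|exact: cg].
- by apply: continuousM; [exact: cf|exact: cg].
Qed.

(** Gives the comparison with a higher power of the norm that confines the search for a minimum to a
    bounded set. *)
Lemma polyfun_growth D f : polyfun D f ->
  exists2 C, 0 <= C & forall (x : 'rV[R]_p) r, 1 <= r ->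
    (forall i, `|x 0 i| <= r) -> `|f x| <= C * r ^+ D.
Proof.
elim=> {D f} [c|i|D f g _ [C C0 fC] _ [C' C'0 gC]|D1 D2 f g _ [C C0 fC] _ [C' C'0 gC]|].
- by exists `|c| => // x r _ _; rewrite expr0 mulr1.
- by exists 1 => // x r _ xr; rewrite expr1 mul1r.
- exists (C + C'); first exact: addr_ge0.
  move=> x r r1 xr; apply: (le_trans (ler_normD _ _)).
  by rewrite mulrDl lerD ?fC ?gC.
- exists (C * C'); first exact: mulr_ge0.
  move=> x r r1 xr; rewrite normrM exprD mulrACA ler_pM //; [exact: fC|exact: gC].
- move=> D1 D2 f leD _ [C C0 fC]; exists C => // x r r1 xr.
  by apply: le_trans (fC x r r1 xr) _; rewrite ler_wpM2l // ler_weXn2l.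
Qed.

(** Keeping the bound [D] instead of [D - 1] is enough: the resulting critical equations have a
    leading term of degree [D + 1]. *)
Lemma polyfun_partial D f (i : 'I_p) : polyfun D f ->
  exists2 g, polyfun D g & forall x t,
    is_derive (t : R) 1 (fun t => f (x + t *: delta_mx 0 i))
      (g (x + t *: delta_mx 0 i)).
Proof.
elim=> {D f} [c|j|D f g _ [f' pf' df] _ [g' pg' dg]|
  D1 D2 f g pf [f' pf' df] pg [g' pg' dg]|].
- by exists (fun=> 0); [exact: polyfun_const|move=> x t; exact: is_derive_cst].
- exists (fun=> (i == j)%:R); first exact: polyfun_const.
  move=> x t; under eq_fun do rewrite !mxE eqxx /= eq_sym.
  set c : R := (i == j)%:R.
  have := is_deriveD (is_derive_cst (x 0 j) t 1)
    (is_deriveM (is_derive_id t 1) (is_derive_cst c t 1)).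
  by rewrite scaler0 !add0r [_ *: _]mulr1.
- exists (fun x => f' x + g' x); first exact: polyfunD.
  by move=> x t; exact: is_deriveD.
- exists (fun x => f x * g' x + g x * f' x).
    by apply: polyfunD; [exact: polyfunM|rewrite addnC; exact: polyfunM].
  by move=> x t; exact: is_deriveM.
- move=> D1 D2 f leD _ [f' pf' df]; exists f' => //.
  exact: polyfun_leq pf'.
Qed.

Definition monomial (a : {ffun 'I_p -> nat}) (x : 'rV[R]_p) : R :=
  \prod_i x 0 i ^+ a i.

Lemma monomialD (a b : {ffun 'I_p -> nat}) x :
  monomial [ffun i => (a i + b i)%N] x = monomial a x * monomial b x.
Proof.
rewrite -big_split; apply: eq_bigr => i _.
by rewrite ffunE exprD.
Qed.

Lemma monomial0 x : monomial [ffun=> 0%N] x = 1.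
Proof. by rewrite /monomial big1 // => i _; rewrite ffunE. Qed.

Lemma monomial1 i x : monomial [ffun j => (j == i : nat)] x = x 0 i.
Proof.
rewrite /monomial (bigD1 i) //= ffunE eqxx big1 ?mulr1 // => j /negPf ji.
by rewrite ffunE ji.
Qed.

Lemma polyfun_monomial (a : {ffun 'I_p -> nat}) :
  polyfun (\sum_i a i) (monomial a).
Proof.
suff pr (r : seq 'I_p) :
    polyfun (\sum_(i <- r) a i) (fun x => \prod_(i <- r) x 0 i ^+ a i) by exact: pr.
elim: r => [|i r IHr].
  by under [X in polyfun _ X]eq_fun do rewrite big_nil; exact: polyfun_const.
under [X in polyfun _ X]eq_fun do rewrite big_cons.
rewrite big_cons; apply: polyfunM => //.
by rewrite -[X in polyfun X]muln1; exact: polyfunX (polyfun_coord i).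
Qed.

Lemma polyfun_monomials D f : polyfun D f ->
  exists2 s : seq (R * {ffun 'I_p -> nat}),
    all (fun ca : R * {ffun 'I_p -> nat} => \sum_i ca.2 i <= D)%N s &
    forall x, f x = \sum_(ca <- s) ca.1 * monomial ca.2 x.
Proof.
elim=> {D f} [c|i|D f g _ [s sD sE] _ [t tD tE]|D1 D2 f g _ [s sD sE] _ [t tD tE]|].
- exists [:: (c, [ffun=> 0%N])] => [|x] /=.
    by rewrite big1 // => i _; rewrite ffunE.
  by rewrite big_seq1 monomial0 mulr1.
- exists [:: (1, [ffun j => (j == i : nat)])] => [|x] /=.
    rewrite (bigD1 i) //= ffunE eqxx big1 // => j /negPf ji.
    by rewrite ffunE ji.
  by rewrite big_seq1 monomial1 mul1r.
- exists (s ++ t) => [|x]; first by rewrite all_cat sD.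
  by rewrite big_cat -sE -tE.
- pose mul (u v : R * {ffun 'I_p -> nat}) :=
    (u.1 * v.1, [ffun i => (u.2 i + v.2 i)%N]).
  exists [seq mul u v | u <- s, v <- t].
    apply/allP => _ /allpairsP[[u v] /= [us vt ->]] /=.
    under eq_bigr do rewrite ffunE.
    rewrite big_split leq_add //.
      exact: (allP sD).
    exact: (allP tD).
  move=> x; rewrite big_allpairs_dep /= sE tE mulr_suml.
  apply: eq_bigr => u _; rewrite mulr_sumr; apply: eq_bigr => v _.
  by rewrite monomialD mulrACA.
- move=> D1 D2 f leD _ [s sD sE]; exists s => //.
  by apply: sub_all sD => ca /leq_trans; exact.
Qed.

(* Modulo the equations every polynomial function is a combination of the
   monomials with all exponents at most E, and the functions on a finite set of
   points are polynomial. *)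
Lemma card_solutions (E : nat) (T : finType) (z : T -> 'rV[R]_p)
    (g : 'I_p -> 'rV[R]_p -> R) :
  injective z -> (forall j, polyfun E (g j)) ->
  (forall t j, z t 0 j ^+ E.+1 = g j (z t)) ->
  (#|T| <= E.+1 ^ p)%N.
Proof.
move=> z_inj pg zE.
pose I := {ffun 'I_p -> 'I_E.+1}.
pose low (b : I) : {ffun 'I_p -> nat} := [ffun i => b i : nat].
pose ev (f : 'rV[R]_p -> R) : 'rV[R]_#|T| := \row_t f (z (enum_val t)).
pose M : 'M[R]_(#|I|, #|T|) := \matrix_b ev (monomial (low (enum_val b))).
have evM (s : seq (R * {ffun 'I_p -> nat})) f :
    (forall x, f x = \sum_(ca <- s) ca.1 * monomial ca.2 x) ->
    (forall ca, ca \in s -> (ev (monomial ca.2) <= M)%MS) -> (ev f <= M)%MS.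
  move=> fE sM.
  have -> : ev f = \sum_(ca <- s) ca.1 *: ev (monomial ca.2).
    apply/rowP => t; rewrite summxE mxE fE; apply: eq_bigr => ca _.
    by rewrite !mxE.
  rewrite big_seq; apply: summx_sub => ca /sM; exact: scalemx_sub.
(* Reduction to low exponents, by induction on the total degree. *)
have monM N (a : {ffun 'I_p -> nat}) :
    (\sum_i a i < N)%N -> (ev (monomial a) <= M)%MS.
  elim: N a => // N IHN a aN.
  have [/forallP a_low|] := boolP [forall i, (a i < E.+1)%N].
    pose b : I := [ffun i => Ordinal (a_low i)].
    have -> : a = low b by apply/ffunP => i; rewrite !ffunE.
    rewrite -[b]enum_rankK.
    by rewrite -(rowK (fun b => ev (monomial (low (enum_val b))))) row_sub.
  rewrite negb_forall => /existsP[j]; rewrite -leqNgt => Eaj.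
  (* Trading the factor [x 0 j ^+ E.+1] for [g j], of degree at most [E], lowers the total degree by
     at least one. *)
  pose a' : {ffun 'I_p -> nat} := [ffun i => a i - (i == j) * E.+1]%N.
  have aE x : monomial a x = monomial a' x * x 0 j ^+ E.+1.
    rewrite /monomial (bigD1 j) //= [in RHS](bigD1 j) //= ffunE eqxx mul1n.
    rewrite mulrAC -exprD subnK //; congr (_ * _).
    by apply: eq_bigr => i /negPf ij; rewrite ffunE ij mul0n subn0.
  have a'N : (\sum_i a' i + E.+1 <= N)%N.
    apply: leq_trans _ (aN : _ <= N)%N.
    rewrite (bigD1 j) //= [in leqRHS](bigD1 j) //= ffunE eqxx mul1n.
    rewrite addnAC subnK // leq_add2l.
    by apply: leq_sum => i _; rewrite ffunE leq_subr.
  have [s sN sE] := polyfun_monomials (polyfunM (polyfun_monomial a') (pg j)).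
  have -> : ev (monomial a) = ev (fun x => monomial a' x * g j x).
    by apply/rowP => t; rewrite !mxE aE zE.
  apply: (evM s) => // ca /(allP sN) caN; apply: IHN.
  by rewrite (leq_ltn_trans caN) // -addnS.
have polyM D f : polyfun D f -> (ev f <= M)%MS.
  move=> /polyfun_monomials[s sD sE]; apply: (evM s) => // ca _.
  exact: monM (ltnSn _).
(* The rows of [M] span all functions on the points, so [#|T|] is at most the number of rows,
   [E.+1 ^ p]. *)
have : (1%:M <= M)%MS.
  apply/row_subP => i; rewrite rowE mulmx1.
  (* Lagrange interpolation: a product of squared distances, vanishing at every point except the
     [i]-th. *)
  pose L (x : 'rV[R]_p) :=
    \prod_(t <- rem (enum_val i) (enum T)) \sum_j (x 0 j - z t 0 j) ^+ 2.
  have LM : (ev L <= M)%MS.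
    apply: (polyM (size (rem (enum_val i) (enum T)) * 2)%N).
    apply: polyfun_prod => t; apply: polyfun_sum => j.
    rewrite -[X in polyfun X]muln1; apply: polyfunX.
    apply: polyfunB; first exact: polyfun_coord.
    exact: polyfun_const.
  have dist0 (x : 'rV[R]_p) t : (\sum_j (x 0 j - z t 0 j) ^+ 2 == 0) = (x == z t).
    rewrite psumr_eq0; last by move=> j _; exact: sqr_ge0.
    apply/allP/eqP => [x0|-> j _]; last by rewrite subrr expr0n eqxx.
    apply/rowP => j; apply/eqP; rewrite -subr_eq0 -sqrf_eq0.
    by rewrite (implyP (x0 j _)) ?mem_index_enum.
  have Li : L (z (enum_val i)) != 0.
    rewrite prodf_seq_neq0; apply/allP => t.
    rewrite (rem_filter _ (enum_uniq _)) mem_filter => /andP[/= ti _].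
    by rewrite dist0 (inj_eq z_inj) eq_sym.
  have evL : ev L = L (z (enum_val i)) *: delta_mx 0 i.
    apply/rowP => t; rewrite !mxE eqxx /=.
    have [->|ti] := eqVneq t i; first by rewrite mulr1.
    rewrite mulr0; apply/eqP; rewrite prodf_seq_eq0; apply/hasP.
    exists (enum_val t); last by rewrite dist0 eqxx.
    rewrite (rem_filter _ (enum_uniq _)) mem_filter mem_enum andbT /=.
    by rewrite (inj_eq enum_val_inj).
  have -> : delta_mx 0 i = (L (z (enum_val i)))^-1 *: ev L.
    by rewrite evL scalerA mulVf // scale1r.
  exact: scalemx_sub.
move/mxrankS; rewrite mxrank1 => /leq_trans -> //.
by rewrite (leq_trans (rank_leq_row _)) // card_ffun !card_ord.
Qed.

(* With F the product of the f i, the function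
   [eta * \sum_j x_j ^+ (2 M D + 2) - F x ^+ 2] is nonnegative on the boundary of
   each cell of sign patterns, tends to infinity, and for small eta is negative
   somewhere in each cell; so it has a critical point in each cell, and its
   critical points solve a system as in [card_solutions]. *)
Lemma card_sign_patterns (D M : nat) (T : finType) (f : 'I_M -> 'rV[R]_p -> R)
    (theta : T -> 'rV[R]_p) :
  (forall i, polyfun D (f i)) ->
  (forall t i, f i (theta t) != 0) ->
  (forall t t', t != t' -> exists i, f i (theta t) * f i (theta t') < 0) ->
  (#|T| <= (2 * (M * D)).+1 ^ p)%N.
Proof.
move=> pf f_neq0 f_sep; set E := (2 * (M * D))%N.
pose F x := \prod_(i <- enum 'I_M) f i x.
have F_neq0 x : (F x != 0) = [forall i, f i x != 0].
  rewrite /F prodf_seq_neq0; apply/allP/forallP => [h i|h i _]; last exact: h.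
  exact: (h i (mem_enum _ i)).
have pF2 : polyfun E (fun x => F x ^+ 2).
  apply: polyfunX; rewrite -[in (M * D)%N](size_enum_ord M).
  exact: polyfun_prod.
(* The exponent is even, so [S] is nonnegative, and it exceeds the degree [E] of the square of
   [F]. *)
pose S (x : 'rV[R]_p) := \sum_j x 0 j ^+ E.+2.
have evenE x : 0 <= x ^+ E.+2 :> R.
  have -> : E.+2 = ((M * D).+1 * 2)%N by rewrite /E; lia.
  by rewrite exprM sqr_ge0.
have S0 x : 0 <= S x by apply: sumr_ge0 => j _.
have [eta eta0 etaP] : exists2 eta : R, 0 < eta &
    forall t, eta * S (theta t) < F (theta t) ^+ 2.
  (* The [+ 1] avoids division by zero and makes the inequality strict; the default 1 covers an
     empty [T]. *)
  exists (\big[Num.min/1]_t (F (theta t) ^+ 2 / (S (theta t) + 1))).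
    apply: lt_bigmin => // t _; rewrite divr_gt0 //.
      by rewrite exprn_even_gt0 //= F_neq0; apply/forallP.
    by rewrite ltr_wpDl.
  move=> t; have F0 : 0 < F (theta t) ^+ 2.
    by rewrite exprn_even_gt0 //= F_neq0; apply/forallP.
  have S1 : 0 < S (theta t) + 1 by rewrite ltr_wpDl.
  apply: (@le_lt_trans _ _ (F (theta t) ^+ 2 / (S (theta t) + 1) * S (theta t))).
    by rewrite ler_wpM2r //; exact: bigmin_le_cond.
  by rewrite mulrAC ltr_pdivrMr // ltr_pM2l // ltrDl.
pose Phi x := eta * S x - F x ^+ 2.
have cPhi : continuous Phi.
  apply: (@polyfun_continuous E.+2); apply: polyfunB.
    apply: polyfunZ; apply: polyfun_sum => j.
    by rewrite -[X in polyfun X]muln1; exact: polyfunX (polyfun_coord j).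
  by apply: polyfun_leq pF2; lia.
have /choice[G GP] j : exists G, polyfun E G /\ forall x t,
    is_derive (t : R) 1 (fun t => F (x + t *: delta_mx 0 j) ^+ 2)
      (G (x + t *: delta_mx 0 j)).
  by have [G pG dG] := polyfun_partial j pF2; exists G.
have cf i : continuous (f i) by exact: polyfun_continuous (pf i).
have /choice[z zP] t : exists x, (forall i, 0 < f i x * f i (theta t)) /\
    forall j, x 0 j ^+ E.+1 = (eta * E.+2%:R)^-1 * G j x.
  (* The closed cell of [theta t], cut down to where [Phi] is nonpositive so that it becomes
     compact. *)
  pose A := [set x | (forall i, 0 <= f i x * f i (theta t)) /\ Phi x <= 0].
  have At : A (theta t).
    split=> [i|]; first by rewrite -expr2 sqr_ge0.
    by rewrite subr_le0 ltW.
  have clA : closed A.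
    have -> : A = (\bigcap_i [set x | 0 <= f i x * f i (theta t)]) `&`
                  [set x | Phi x <= 0].
      apply/seteqP; split=> x /= [h1 h2]; split=> // i; last exact: h1.
      by move=> _; exact: h1.
    apply: closedI.
      apply: closed_bigI => i _.
      apply: (closed_comp (f := fun x => f i x * f i (theta t)) _ (@closed_ge _ 0)).
      by move=> x _; apply: continuousM; [exact: cf|exact: cst_continuous].
    by apply: (closed_comp _ (@closed_le _ 0)) => x _; exact: cPhi.
  have bdA : bounded_set A.
    have [C C0 FC] := polyfun_growth pF2.
    (* For [x] in [A] with norm at least 1, [eta * S x <= F x ^+ 2] gives [|x| ^+ 2 <= C / eta],
       which is impossible once [|x|] also exceeds [C / eta]. *)
    exists (1 + C / eta); split; first exact: num_real.
    move=> r rC x [_ Ax]; have Ce : 0 <= C / eta by rewrite divr_ge0 // ltW.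
    rewrite /= leNgt; apply/negP => rx.
    have x1 : 1 <= `|x|.
      by apply: ltW; apply: lt_trans rx; apply: le_lt_trans rC; rewrite lerDl.
    have xC : C / eta < `|x|.
      by apply: lt_trans rx; apply: le_lt_trans rC; rewrite lerDr.
    have [[i0 j] xj] : exists i, mx_norm x = `|x i.1 i.2|.
      apply: mx_norm_neq0; apply/negP => /eqP xn.
      by move: x1; rewrite /Num.norm /= xn ler10.
    rewrite /= [i0]ord1 in xj; have xj' : `|x| = `|x 0 j| by [].
    have := FC x `|x| x1 _; rewrite ger0_norm ?sqr_ge0 // => FCx.
    have {}FCx : F x ^+ 2 <= C * `|x| ^+ E.
      apply: FCx => i; rewrite {2}/Num.norm /= mx_normrE.
      exact: (le_bigmax _ (fun ij => `|x ij.1 ij.2|) (0, i)).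
    have : eta * `|x| ^+ E.+2 <= C * `|x| ^+ E.
      apply: le_trans FCx; move: Ax; rewrite subr_le0; apply: le_trans.
      rewrite ler_wpM2l ?(ltW eta0) // /S (bigD1 j) //= xj' -normrX ger0_norm //.
      by rewrite lerDl sumr_ge0.
    rewrite -addn2 exprD [`|x| ^+ E * _]mulrC mulrA.
    rewrite ler_pM2r; last by rewrite exprn_gt0 // (lt_le_trans ltr01).
    apply/negP; rewrite -ltNge mulrC -ltr_pdivrMr // (lt_le_trans xC) //.
    by rewrite expr2 ler_peMr // (le_trans ler01).
  have [c /set_mem[Ac Ac'] cmin] := EVT_min_rV (ex_intro _ _ At)
    (bounded_closed_compact bdA clA) (continuous_subspaceT cPhi).
  have Phic : Phi c < 0.
    by apply: le_lt_trans (cmin _ (mem_set At)) _; rewrite subr_lt0.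
  (* At a zero of [F] the value of [Phi] is nonnegative, so the minimizer lies in the open cell. *)
  have /forallP fc : [forall i, f i c != 0].
    rewrite -F_neq0; apply: contraTneq Phic => Fc0.
    by rewrite -leNgt /Phi Fc0 expr0n subr0 mulr_ge0 // ltW.
  have fc0 i : 0 < f i c * f i (theta t).
    by rewrite lt_neqAle Ac eq_sym mulf_neq0.
  exists c; split=> // j.
  pose path (s : R) := c + s *: delta_mx 0 j.
  have path0 : path 0 = c by rewrite /path scale0r addr0.
  have cpath : continuous path.
    by move=> s; apply: cvgD; [exact: cvg_cst|exact: scalel_continuous].
  (* The conditions defining [A] hold strictly at [c], hence persist nearby along the coordinate
     line; the minimum over [A] is thus a local minimum on it. *)
  have [e e0 eP] : exists2 e : R, 0 < e & forall s, `|s| < e -> A (path s).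
    have : \forall s \near (0 : R), Phi (path s) < 0 /\
        forall i, 0 < f i (path s) * f i (theta t).
      apply: filterI.
        have : {for 0, continuous (Phi \o path)}.
          by apply: continuous_comp; [exact: cpath|exact: cPhi].
        by move=> /cvgr_lt; apply; rewrite /= path0.
      apply: (@filter_forall R 'I_M (fun i s => 0 < f i (path s) * f i (theta t))
        (nbhs (0 : R)) _) => i.
      have : {for 0, continuous (fun s => f i (path s) * f i (theta t))}.
        apply: continuousM; last exact: cst_continuous.
        by apply: continuous_comp; [exact: cpath|exact: cf].
      by move=> /cvgr_gt; apply; rewrite /= path0.
    move=> /nbhs_ballP[e /= e0 eP]; exists e => // s se.
    have [|Ps fs] := eP s; first by rewrite /ball /= sub0r normrN.
    by split; [move=> i; exact: ltW|exact: ltW].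
  have dPhi (s : R) : is_derive s 1 (Phi \o path)
      (eta * (E.+2%:R * path s 0 j ^+ E.+1) - G j (path s)).
    have -> : Phi \o path = (fun s => eta *
        (\sum_(l | l != j) c 0 l ^+ E.+2 + (c 0 j + s) ^+ E.+2) -
        F (path s) ^+ 2).
      apply/funext => u; rewrite /= /Phi /S (bigD1 j) //= addrC.
      congr (eta * (_ + _) - _); last by rewrite !mxE !eqxx mulr1.
      by apply: eq_bigr => l /negPf lj; rewrite !mxE lj mulr0 addr0.
    have [_ dG] := GP j.
    have dX : is_derive s 1 (fun u => (c 0 j + u) ^+ E.+2)
        (E.+2%:R * path s 0 j ^+ E.+1).
      have -> : (fun u => (c 0 j + u) ^+ E.+2) = (cst (c 0 j) + id) ^+ E.+2.
        by apply/funext => u; rewrite exprfctE.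
      have := is_deriveX E.+2
        (is_deriveD (is_derive_cst (c 0 j) s 1) (is_derive_id s 1)).
      by rewrite add0r [_ *: 1]mulr1 !mxE !eqxx mulr1; exact.
    set K := \sum_(l | l != j) _.
    have := is_deriveB (is_deriveZ eta (is_deriveD (is_derive_cst K s 1) dX)) (dG c s).
    by rewrite add0r.
  have d0 : is_derive (0 : R) 1 (Phi \o path) 0.
    apply: (@derive1_at_min _ _ (- e) e).
    - by rewrite ge0_cp // ltW.
    - by move=> s _; have [] := dPhi s.
    - by rewrite in_itv /= oppr_lt0 e0.
    - move=> s; rewrite in_itv /= => se; rewrite path0; apply: cmin.
      by apply/mem_set/eP; rewrite ltr_norml.
  have [_ dv] := dPhi 0; have [_ dv0] := d0.
  move: dv; rewrite dv0 path0 => /eqP; rewrite eq_sym subr_eq0 mulrA => /eqP <-.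
  by rewrite mulKf // mulf_neq0 ?gt_eqF.
pose g j x := (eta * E.+2%:R)^-1 * G j x.
apply: (@card_solutions E T z g).
(* A common critical point would have the signs of both cells, but some [f l] takes opposite signs
   on them. *)
- move=> t t' ztt'; apply/eqP; apply: contraT => /f_sep[l].
  have [zt _] := zP t; have [zt' _] := zP t'.
  have := mulr_gt0 (zt l) (zt' l); rewrite ztt' mulrACA -expr2.
  move=> h; rewrite ltNge -(pmulr_rge0 _ (_ : 0 < f l (z t') ^+ 2)) ?(ltW h) //.
  by rewrite exprn_even_gt0 //; apply: contraTneq (zt' l) => ->; rewrite mul0r ltxx.
- by move=> j; apply: polyfunZ; have [] := GP j.
- by move=> t j; have [_] := zP t; exact.
Qed.

End PolynomialFunctions.

(** * Counting the subfunctions of a program across a cut *)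

Section SubfunctionCount.
Variables (R : realType) (k n w : nat) (P : kQOBDD R k n w).

(** Extended by the identity beyond the last step, so that steps can be handled as plain naturals
    and cut into [iota] segments. *)
Definition gate_at (s : nat) (b : bool) : 'M[R[i]]_w :=
  if insub s is Some s' then qgate P s' b else 1%:M.

Definition segment_mx (tau : nat -> bool) (l : seq nat) : 'M[R[i]]_w :=
  foldl (fun M s => gate_at s (tau (s %% n)%N) *m M) 1%:M l.

Lemma segment_mx_rcons tau l s :
  segment_mx tau (rcons l s) = gate_at s (tau (s %% n)%N) *m segment_mx tau l.
Proof. by rewrite /segment_mx foldl_rcons. Qed.

Lemma segment_mx_cat tau l1 l2 :
  segment_mx tau (l1 ++ l2) = segment_mx tau l2 *m segment_mx tau l1.
Proof.
elim/last_ind: l2 => [|l2 s IHl]; first by rewrite cats0 mul1mx.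
by rewrite -rcons_cat !segment_mx_rcons IHl mulmxA.
Qed.

Lemma eq_segment_mx tau tau' l :
  (forall s, s \in l -> tau (s %% n)%N = tau' (s %% n)%N) ->
  segment_mx tau l = segment_mx tau' l.
Proof.
elim/last_ind: l => // l s IHl eq_tau.
rewrite !segment_mx_rcons eq_tau ?mem_rcons ?mem_head // IHl // => u ul.
by rewrite eq_tau // mem_rcons in_cons ul orbT.
Qed.

Lemma segment_mx_rounds tau K :
  segment_mx tau (iota 0 (K * n)) =
  foldl (fun M r => segment_mx tau (iota (r * n) n) *m M) 1%:M (iota 0 K).
Proof.
elim: K => // K IHK.
by rewrite -[in RHS]addn1 iotaD foldl_cat /= -IHK mulSn addnC iotaD segment_mx_cat.
Qed.

Lemma qfinal_segment_mx (sigma : {ffun 'I_n -> bool}) (tau : nat -> bool) :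
  qorder P = 1%g -> (forall i : 'I_n, sigma i = tau i) ->
  qfinal P sigma = segment_mx tau (iota 0 (k * n)) *m delta_mx (qinit P) 0.
Proof.
move=> ord1 sigmaE; rewrite /qfinal -val_enum_ord.
elim/last_ind: (enum _) => [|l s IHl] /=; first by rewrite mul1mx.
rewrite foldl_rcons map_rcons segment_mx_rcons -mulmxA -IHl /qstep ord1 perm1.
by rewrite sigmaE /gate_at valK.
Qed.

(** Both parts are indexed by absolute input positions; [b] is not shifted by [c]. *)
Definition glue (c : nat) (a b : nat -> bool) : {ffun 'I_n -> bool} :=
  [ffun i : 'I_n => if (i < c)%N then a i else b i].

(** With the natural order each round reads all positions before the cut and then all those after
    it, so it factors into a matrix of [a] followed by a matrix of [b]. *)
Lemma qfinal_glue c a b : (c <= n)%N -> qorder P = 1%g ->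
  qfinal P (glue c a b) =
  foldl (fun v r => segment_mx b (iota (r * n + c) (n - c)) *m
                    (segment_mx a (iota (r * n) c) *m v))
    (delta_mx (qinit P) 0) (iota 0 k).
Proof.
move=> cn ord1; pose tau i := if (i < c)%N then a i else b i.
rewrite (@qfinal_segment_mx _ tau) // => [|i]; last by rewrite ffunE.
rewrite segment_mx_rounds.
elim/last_ind: (iota 0 k) => [|l r IHl] /=; first by rewrite mul1mx.
rewrite !foldl_rcons -mulmxA IHl.
have -> : iota (r * n) n = iota (r * n) c ++ iota (r * n + c) (n - c).
  by rewrite -iotaD subnKC.
rewrite segment_mx_cat -mulmxA.
have taua : segment_mx tau (iota (r * n) c) = segment_mx a (iota (r * n) c).
  apply: eq_segment_mx => s; rewrite mem_iota => /andP[h1 h2].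
  have -> : (s %% n = s - r * n)%N.
    by rewrite -[in LHS](subnKC h1) modnMDl modn_small //; lia.
  by rewrite /tau; case: ltnP => //; lia.
rewrite taua (@eq_segment_mx tau b) // => s; rewrite mem_iota => /andP[h1 h2].
have -> : (s %% n = s - r * n)%N.
  rewrite -[in LHS](subnKC (leq_trans (leq_addr c _) h1)) modnMDl modn_small //; lia.
by rewrite /tau; case: ltnP => //; lia.
Qed.

(* The part of the input read after the cut enters the computation only through k
   complex w x w matrices, and the acceptance probability is a polynomial of
   degree 2k in their 2kw^2 real coordinates. *)
Lemma card_subfunctions (f : boolfun n) (c M : nat) (T : finType)
    (a : 'I_M -> nat -> bool) (b : T -> nat -> bool) :
  (c <= n)%N -> qorder P = 1%g -> computes_bounded_error P f ->
  (forall t t', t != t' ->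
    exists y, f (glue c (a y) (b t)) != f (glue c (a y) (b t'))) ->
  (#|T| <= (2 * (M * (2 * k))).+1 ^ (2 * (k * (w * w))))%N.
Proof.
move=> cn ord1 [eps eps0 fP] sep.
pose I : finType := (bool * ('I_k * ('I_w * 'I_w)))%type.
pose B t (r : nat) := segment_mx (b t) (iota (r * n + c) (n - c)).
pose A y (r : nat) := segment_mx (a y) (iota (r * n) c).
pose entry t (u : I) : R := let: (re, (r, (i, j))) := u in
  if re then complex.Re (B t r i j) else complex.Im (B t r i j).
pose theta t : 'rV[R]_#|I| := \row_q entry t (enum_val q).
pose coord re r i j (x : 'rV[R]_#|I|) := x 0 (enum_rank ((re, (r, (i, j))) : I)).
(* The suffix matrices with their real and imaginary parts as free variables; unitarity is not
   imposed. *)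
pose Bx (x : 'rV[R]_#|I|) (r : 'I_k) : 'M[R[i]]_w :=
  \matrix_(i, j) (coord true r i j x +i* coord false r i j x)%C.
have BxE t r : Bx (theta t) r = B t r.
  apply/matrixP => i j; rewrite mxE /coord !mxE !enum_rankK /=.
  by case: (B t r i j).
pose psi y (l : seq 'I_k) x := foldl (fun v r => Bx x r *m (A y r *m v))
  (delta_mx (qinit P) 0 : 'cV[R[i]]_w) l.
pose cpoly D (h : 'rV[R]_#|I| -> R[i]) :=
  polyfun D (fun x => complex.Re (h x)) /\ polyfun D (fun x => complex.Im (h x)).
have cpolyM D1 D2 h1 h2 : cpoly D1 h1 -> cpoly D2 h2 ->
    cpoly (D1 + D2)%N (fun x => h1 x * h2 x).
  move=> [r1 i1] [r2 i2]; split.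
    have -> : (fun x => complex.Re (h1 x * h2 x)) = (fun x =>
        complex.Re (h1 x) * complex.Re (h2 x) - complex.Im (h1 x) * complex.Im (h2 x)).
      by apply/funext => x; case: (h1 x) (h2 x) => [? ?] [? ?].
    by apply: polyfunB; exact: polyfunM.
  have -> : (fun x => complex.Im (h1 x * h2 x)) = (fun x =>
      complex.Re (h1 x) * complex.Im (h2 x) + complex.Im (h1 x) * complex.Re (h2 x)).
    by apply/funext => x; case: (h1 x) (h2 x) => [? ?] [? ?].
  by apply: polyfunD; exact: polyfunM.
have cpolyS D (J : finType) (h : J -> 'rV[R]_#|I| -> R[i]) :
    (forall j, cpoly D (h j)) -> cpoly D (fun x => \sum_j h j x).
  move=> ph; split.
    under eq_fun do rewrite raddf_sum; apply: polyfun_sum => j.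
    by have [] := ph j.
  under eq_fun do rewrite raddf_sum; apply: polyfun_sum => j.
  by have [] := ph j.
(* Each round applies one constant matrix and one matrix of variables, so the degree grows by one
   per round. *)
have cpoly_psi y l i : cpoly (size l) (fun x => psi y l x i 0).
  elim/last_ind: l i => [|l r IHl] i.
    by split; exact: polyfun_const.
  rewrite size_rcons /psi; under eq_fun do rewrite foldl_rcons mxE.
  apply: (cpolyS _) => j; rewrite -add1n; apply: (cpolyM _ _).
    by under eq_fun do rewrite mxE; split; exact: polyfun_coord.
  under eq_fun do rewrite mxE.
  apply: (cpolyS _) => l'; rewrite -[size l]add0n; apply: cpolyM => //.
  by split; exact: polyfun_const.
pose acc y x := \sum_(i in qaccept P)
  ComplexField.Normc.normc (psi y (enum 'I_k) x i 0) ^+ 2 - 1 / 2.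
have psiE y t : psi y (enum 'I_k) (theta t) = qfinal P (glue c (a y) (b t)).
  rewrite qfinal_glue // -val_enum_ord /psi.
  elim/last_ind: (enum _) => // l r IHl.
  by rewrite map_rcons !foldl_rcons IHl BxE.
have accE y t : acc y (theta t) = accept_prob P (glue c (a y) (b t)) - 1 / 2.
  by rewrite /acc psiE.
(* The gap [eps] makes [acc] nonzero at every [theta t], with sign given by [f]; its size does not
   matter. *)
have acc_sign y t : (f (glue c (a y) (b t)) /\ 0 < acc y (theta t)) \/
                   (~~ f (glue c (a y) (b t)) /\ acc y (theta t) < 0).
  rewrite accE; have [h1 h0] := fP (glue c (a y) (b t)).
  case: (f _) h1 h0 => [/(_ erefl) h _|_ /(_ erefl) h]; [left|right]; split=> //; lra.
have -> : (2 * (k * (w * w)))%N = #|I|.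
  by rewrite !card_prod card_bool !card_ord.
apply: (@card_sign_patterns R #|I| (2 * k) M T acc theta).
- move=> y; apply: polyfunB; last exact: polyfun_const.
  apply: polyfun_sum => i.
  (* The squared modulus is a polynomial in the real and imaginary parts, which doubles the degree
     from [k] to [2 * k]. *)
  have -> : (fun x => ComplexField.Normc.normc (psi y (enum 'I_k) x i 0) ^+ 2) =
      (fun x => complex.Re (psi y (enum 'I_k) x i 0) ^+ 2 +
                complex.Im (psi y (enum 'I_k) x i 0) ^+ 2).
    apply/funext => x; case: (psi _ _ _ _ _) => u v /=.
    by rewrite sqr_sqrtr // addr_ge0 // sqr_ge0.
  have [pr pi] := cpoly_psi y (enum 'I_k) i; rewrite size_enum_ord in pr pi.
  by apply: polyfunD; exact: polyfunX.
- by move=> t y; case: (acc_sign y t) => [[_ /lt0r_neq0]|[_ /ltr0_neq0]].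
- move=> t t' /sep[y fy]; exists y; move: fy.
  case: (acc_sign y t) => [[-> h]|[/negPf -> h]];
    case: (acc_sign y t') => [[-> h']|[/negPf -> h']] // _.
    by rewrite pmulr_rlt0.
  by rewrite nmulr_rlt0.
Qed.

End SubfunctionCount.

(** * Reversible programs as quantum programs *)

Section ReversiblePrograms.
Variables (R : realType) (k n : nat).

Definition fun_mx (w : nat) (g : 'I_w -> 'I_w) : 'M[R[i]]_w :=
  \matrix_(i, j) (i == g j)%:R.

Lemma fun_mx_unitary w (g : 'I_w -> 'I_w) : injective g -> fun_mx g \is unitarymx.
Proof.
move=> g_inj; apply/unitarymxP/matrixP => i i'; rewrite !mxE.
under eq_bigr do rewrite !mxE.
rewrite -(reindex g (onW_bij _ (injF_bij g_inj)) (P := xpredT)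
  (F := fun l => (i == l)%:R * ((i' == l)%:R : R[i])^*)) /=.
rewrite (bigD1 i) //= eqxx mul1r big1 ?addr0 ?conjC_nat => [|l /negPf li].
  by rewrite eq_sym.
by rewrite eq_sym li mul0r.
Qed.

Lemma fun_mx_delta w (g : 'I_w -> 'I_w) i :
  fun_mx g *m delta_mx i 0 = delta_mx (g i) 0 :> 'cV_w.
Proof.
by rewrite -colE; apply/colP => j; rewrite !mxE andbT.
Qed.

(** An injective step on a finite set acts by a permutation matrix, so the state stays a basis
    vector and the acceptance probability is 0 or 1, with gap 1/2. *)
Lemma reversible_QOBDD (T : finType) (u0 : T) (acc : pred T)
    (step : 'I_(k * n) -> bool -> T -> T) (f : boolfun n) (W : R) :
  (forall s b, injective (step s b)) ->
  (forall sigma, f sigma =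
    acc (foldl (fun u s => step s (sigma (read_pos s)) u) u0 (enum 'I_(k * n)))) ->
  #|T|%:R <= W -> id_QOBDD k W f.
Proof.
move=> step_inj fE TW.
pose g s b (i : 'I_#|T|) := enum_rank (step s b (enum_val i)).
have g_unitary s b : fun_mx (g s b) \is unitarymx.
  by apply: fun_mx_unitary => i j /enum_rank_inj /step_inj /enum_val_inj.
pose P := KQOBDD 1%g (enum_rank u0) [set i | acc (enum_val i)] g_unitary.
exists #|T|, P; split=> //.
have finalE sigma : qfinal P sigma = delta_mx (enum_rank
    (foldl (fun u s => step s (sigma (read_pos s)) u) u0 (enum 'I_(k * n)))) 0.
  rewrite /qfinal; elim/last_ind: (enum _) => // l s IHl.
  by rewrite !foldl_rcons IHl /qstep perm1 fun_mx_delta /g enum_rankK.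
have probE sigma : accept_prob P sigma = (f sigma)%:R.
  rewrite /accept_prob finalE fE; set u := foldl _ _ _.
  have normcE (b : bool) : ComplexField.Normc.normc (b%:R : R[i]) ^+ 2 = b%:R.
    by case: b; rewrite /= ?expr1n ?expr0n /= ?addr0 ?sqrtr0 ?sqrtr1 ?expr1n ?expr0n.
  under eq_bigr do rewrite mxE eqxx andbT normcE.
  case: (boolP (acc u)) => accu.
    rewrite (bigD1 (enum_rank u)) ?inE ?enum_rankK //= eqxx big1 ?addr0 // => i.
    by case/andP=> _ /negPf ->.
  rewrite big1 // => i; rewrite inE; case: eqP => // ->.
  by rewrite enum_rankK (negPf accu).
exists (1 / 2); first by rewrite divr_gt0.
by move=> sigma; rewrite probE; split=> -> /=; lra.
Qed.

Lemma id_QOBDD_true (W : R) : 1 <= W -> id_QOBDD k W ((fun=> true) : boolfun n).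
Proof.
move=> W1; apply: (@reversible_QOBDD unit tt xpredT (fun _ _ => id)) => //.
  by move=> s b.
by rewrite card_unit.
Qed.

End ReversiblePrograms.

(** * The address function *)

(** Below [m] the truncated subtraction returns the bit [x] has at 0; this is harmless, as
    [glue n m] consults it only from position [m] on. *)
Definition data_bits (m : nat) (x : {ffun 'I_m -> bool}) (i : nat) : bool :=
  if insub (i - m)%N is Some l then x l else false.

(* Adding the positions of the ones among the first m bits modulo m yields an
   address (bits with a single one address their position); the addressed one of
   the next m bits is then copied into a flag. *)
Lemma address_function (R : realType) (k n m : nat) (W : R) :
  (0 < k)%N -> (0 < m)%N -> (m + m <= n)%N -> (2 * m)%:R <= W ->
  exists2 f : boolfun n, id_QOBDD k W f &
    forall (j : 'I_m) x, f (glue n m (pred1 (j : nat)) (data_bits x)) = x j.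
Proof.
case: m => // q k0 _ mn mW; set m := q.+1 in mn mW *.
pose T : finType := ('I_m * bool)%type.
(* Here [s] is the global step number, not the position. As [u.1 + m < 2 * m], every step from
   [2 * m] on is idle, including all later rounds. *)
pose step (s : nat) (b : bool) (u : T) : T :=
  if ~~ b then u else if (s < m)%N then (u.1 + inZp s, u.2)
  else (u.1, u.2 (+) (u.1 + m == s)%N).
have step_inj s b : injective (step s b).
  rewrite /step => -[a c] [a' c']; case: b => //=.
  case: ifP => _ h; have h1 := congr1 fst h; have h2 := congr1 snd h.
    by rewrite (addIr _ h1) (h2 : c = c').
  by move: h2; rewrite /= (h1 : a = a') => /addIb ->.
pose f (sigma : {ffun 'I_n -> bool}) :=
  (foldl (fun u s => step (val s) (sigma (read_pos s)) u) (0, false)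
    (enum 'I_(k * n))).2.
exists f.
  apply: (@reversible_QOBDD R k n T (0, false) snd (fun s b => step s b)) => //.
  by rewrite card_prod card_ord card_bool mulnC.
move=> j x; pose tau i := if (i < m)%N then i == j else data_bits x i.
pose st t := foldl (fun u s => if (s < m + m)%N then step s (tau s) u else u)
  ((0, false) : T) (iota 0 t).
have stS t : st t.+1 = if (t < m + m)%N then step t (tau t) (st t) else st t.
  by rewrite /st -[in LHS]addn1 iotaD foldl_cat.
(* After [t] steps the address is set once the single one at [j] has been read, and the flag holds
   the answer once step [m + j] is done. *)
have stE t : st t = if (t <= j)%N then (0, false) else (j, (m + j < t)%N && x j).
  elim: t => // t IHt; rewrite stS IHt.
  have jm := ltn_ord j; rewrite /step /tau.
  have [tm|mt] := ltnP t m.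
    rewrite (leq_trans tm) ?leq_addr //.
    have -> : (m + j < t.+1)%N = false by lia.
    have -> : (m + j < t)%N = false by lia.
    have [->|tj] := eqVneq t j; first by rewrite leqnn ltnn /= add0r valZpK.
    by rewrite [(t < j)%N]ltn_neqAle tj.
  have -> : (t <= j)%N = false by lia.
  have -> : (t < j)%N = false by lia.
  case: ltnP => tmm; last by congr (_, _ && _); lia.
  rewrite /data_bits; case: insubP => [l _ lE|]; last by lia.
  rewrite /= [(j + m)%N]addnC; have [tE|tj] := eqVneq (m + j)%N t.
    have -> : l = j by apply: val_inj; rewrite /= lE -tE addKn.
    by rewrite -tE ltnn ltnSn; case: (x j).
  have -> : (m + j < t.+1)%N = (m + j < t)%N by lia.
  by rewrite addbF if_same.
rewrite /f; have -> : foldl (fun u s => step (val s) (glue n m (pred1 (j : nat))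
    (data_bits x) (read_pos s)) u) (0, false) (enum 'I_(k * n)) = st (k * n)%N.
  rewrite /st -val_enum_ord; elim/last_ind: (enum _) => // l s IHl.
  rewrite map_rcons !foldl_rcons IHl; case: ltnP => sm.
    by rewrite ffunE /= modn_small // (leq_trans sm).
  rewrite /step; case: (glue _ _ _ _ _) => //=.
  rewrite ltnNge (leq_trans _ sm) ?leq_addr //=.
  move: (foldl _ _ _) => -[u b] /=.
  by rewrite (ltn_eqF (leq_trans _ sm)) ?addbF // ltn_add2r.
have nk : (n <= k * n)%N by rewrite leq_pmull.
have jm := ltn_ord j; rewrite stE leqNgt (_ : (j < k * n)%N) /=; last by lia.
by rewrite (_ : (m + j < k * n)%N) //; lia.
Qed.

(** * Choice of parameters and the strict inclusion *)

Lemma double_leq_exp2 t : (2 * t <= 2 ^ t)%N.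
Proof.
elim: t => // -[|t] // IHt; rewrite expnS mulnS.
have : (2 <= 2 ^ t.+1)%N by rewrite -{1}(expn1 2) leq_exp2l.
by lia.
Qed.

(** Write [t] for the logarithm and [v] for [k * (w * w)]. The base is at most [d ^ 3], hence at
    most [2 ^ (6 * t)], and the exponent is [2 * v]; then [12 * v * t < 16 * v * t <= d * t = m] if
    [v] is positive. *)
Lemma subfunction_count_lt k d w : (0 < k)%N -> (16 * k <= d)%N ->
  (16 * (k * (w * w)) <= d)%N ->
  let m := (d * trunc_log 2 d)%N in
  ((2 * (m * (2 * k))).+1 ^ (2 * (k * (w * w))) < 2 ^ m)%N.
Proof.
move=> k0 kd; move: (k * (w * w))%N => v vd.
have d0 : (0 < d)%N by lia.
have /andP[td dt] := @trunc_log_bounds 2 d isT d0.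
set t := trunc_log 2 d in td dt * => /=.
have t0 : (0 < t)%N.
  by rewrite lt0n; apply: contraTneq dt => ->; rewrite -leqNgt; lia.
have t_le_d : (t <= d)%N by apply: leq_trans td; apply: ltnW; exact: ltn_expl.
have base : ((2 * (d * t * (2 * k))).+1 <= 2 ^ (6 * t))%N.
  apply: (@leq_trans (d * d * d)).
    have : (d * t * (16 * k) <= d * d * d)%N by rewrite leq_mul // leq_mul.
    have : (d <= d * d * d)%N by rewrite -mulnA leq_pmulr // muln_gt0 d0.
    by lia.
  apply: (@leq_trans ((2 ^ t.+1) ^ 3)).
    by rewrite !expnS expn0 muln1 mulnA !leq_mul // ltnW // -expnS.
  by rewrite -expnM leq_exp2l //; lia.
have [->|v0] := posnP v.
  by rewrite muln0 expn0 -{1}(expn0 2) ltn_exp2l // muln_gt0 d0.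
apply: (@leq_ltn_trans ((2 ^ (6 * t)) ^ (2 * v))).
  by rewrite leq_exp2r ?muln_gt0.
rewrite -expnM ltn_exp2l //.
have : (16 * v * t <= d * t)%N by rewrite leq_mul.
have : (0 < v * t)%N by rewrite muln_gt0 v0.
by nia.
Qed.

Theorem theorem4 (R : realType) :
  exists2 C1 : R, 0 < C1 &
    forall k d : nat -> nat,
      (forall n, (0 < k n)%N) ->
      (forall n, (0 < d n)%N) ->
      (fun n : nat => (k n)%:R * (d n)%:R * log2 (d n)%:R : R^o)
        =o_\oo (fun n : nat => n%:R : R^o) ->
      \forall n \near \oo,
        id_QOBDD (k n) (n := n) (Num.sqrt ((d n)%:R / (C1 * (k n)%:R))) `<`
        id_QOBDD (k n) (n := n) ((d n)%:R ^+ 2 : R).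
Proof.
exists 16; first by [].
move=> k d k_gt0 d_gt0 /eqoP small.
(* The little-o bound with constant 1/4 yields [m <= n / 4], more than enough for [m + m <= n]. *)
have quarter : 0 < 1 / 4 :> R by rewrite divr_gt0.
near=> n.
have : `|(k n)%:R * (d n)%:R * log2 (d n)%:R| <= 1 / 4 * `|n%:R : R^o| :> R.
  by near: n; exact: small.
move: (k_gt0 n) (d_gt0 n); move: (k n) (d n) => K d' K0 d0.
rewrite [`|n%:R|]normr_nat => kdn.
have dR1 : 1 <= d'%:R :> R by rewrite ler1n.
have KR1 : 1 <= K%:R :> R by rewrite ler1n.
have K16 : 0 < 16 * K%:R :> R by rewrite mulr_gt0 // ltr0n.
have width_sqr (w : nat) : w%:R <= Num.sqrt (d'%:R / (16 * K%:R)) :> R ->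
    (16 * (K * (w * w)) <= d')%N.
  move=> wW; rewrite -(ler_nat R) !natrM mulrA mulrC -ler_pdivlMr //.
  rewrite -expr2 -(@sqr_sqrtr _ (d'%:R / _)); last by rewrite divr_ge0 // ltW.
  by rewrite lerXn2r ?nnegrE ?sqrtr_ge0.
split.
  move=> f [w [P [wW ord1 fP]]]; exists w, P; split=> //.
  apply: le_trans wW _.
  (* The inclusion compares widths under the root: [d' / (16 * K) <= d' <= d' ^ 4]. *)
  rewrite -[leRHS]ger0_norm ?sqr_ge0 // -sqrtr_sqr ler_wsqrtr //.
  apply: (@le_trans _ _ d'%:R); first by rewrite ler_pdivrMr // ler_peMr //; lra.
  by rewrite -exprM ler_eXnr.
have [dK|Kd] := ltnP d' (16 * K).
  (* The constant function true lies in the larger class; a program of positive width in the smaller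
     one would force [16 * K <= d']. *)
  move=> /(_ _ (id_QOBDD_true K n (exprn_ege1 2 dR1)))[w [P [/width_sqr]]].
  have w0 : (0 < w)%N := leq_ltn_trans (leq0n _) (ltn_ord (qinit P)).
  have : (16 * K <= 16 * (K * (w * w)))%N by rewrite leq_mul2l leq_pmulr // muln_gt0 w0.
  by lia.
pose t := trunc_log 2 d'; pose m := (d' * t)%N.
have /andP[td dt] : (2 ^ t <= d' < 2 ^ t.+1)%N by exact: trunc_log_bounds.
have m0 : (0 < m)%N.
  rewrite muln_gt0 d0 lt0n; apply: contraTneq dt => ->; rewrite -leqNgt; lia.
have tlog : t%:R <= log2 d'%:R :> R.
  rewrite /log2 ler_pdivlMr ?ln_gt0 ?ltr1n // mulr_natl -lnXn //.
  by rewrite ler_ln ?posrE ?exprn_gt0 ?ltr0n // -natrX ler_nat.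
have mn : (m + m <= n)%N.
  rewrite -(ler_nat R) natrD natrM.
  have : d'%:R * t%:R <= K%:R * d'%:R * log2 d'%:R :> R.
    rewrite ler_pM // ?ler_peMl //.
  have := le_trans (ler_norm _) kdn.
  have : 0 <= n%:R :> R by [].
  by lra.
have mW : (2 * m)%:R <= d'%:R ^+ 2 :> R.
  (* Reduces to [2 * t <= 2 ^ t <= d']. *)
  rewrite -natrX ler_nat mulnCA -mulnn leq_mul2l (leq_trans _ td) ?orbT //.
  exact: double_leq_exp2.
have [f fbig fE] := address_function K0 m0 mn mW.
move=> /(_ f fbig)[w [P [/width_sqr wd ord1 fP]]].
(* Distinct data words differ at some bit [j], and the prefix addressing [j] exposes it. *)
have sep (x x' : {ffun 'I_m -> bool}) : x != x' -> exists j : 'I_m,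
    f (glue n m (pred1 (j : nat)) (data_bits x)) !=
    f (glue n m (pred1 (j : nat)) (data_bits x')).
  move=> xx'; suff /existsP[j xj] : [exists j, x j != x' j].
    by exists j; rewrite !fE.
  apply: contraNT xx'; rewrite negb_exists => /forallP eqx.
  by apply/eqP/ffunP => j; apply/eqP; rewrite -[_ == _]negbK.
have := card_subfunctions (leq_trans (leq_addr m m) mn) ord1 fP sep.
apply/negP; rewrite card_ffun card_bool card_ord -ltnNge.
exact: subfunction_count_lt.
Unshelve. all: by end_near.
Qed.
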